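(* Let $S=U\bowtie A$ be a Zappa–Szép product of monoids such that $S$ is a right LCM semigroup, $A$ is a right LCM semigroup (so that $U$ is also right LCM), and for all $(u,a),(v,b)\in S$: if $uU\cap vU=wU$ for some $w\in U$, then $(u,a)S\cap(v,b)S=(w,c)S$ for some $c\in A$. Then $S$ is admissible if and only if $U$ is admissible with a generalised scale that is invariant under the action of $A$ on $U$ (that is, a generalised scale $N'$ on $U$ with $N'_{a(u)}=N'_u$ for all $a\in A$, $u\in U$).
   Context: All semigroups are countable discrete monoids; $\mathbb{N}^\times$ is the multiplicative monoid of positive integers. **Zappa–Szép products.** Let $U,A$ be monoids with maps $A\times U\to U$, $(a,u)\mapsto a(u)$ (action) and $A\times U\to A$, $(a,u)\mapsto a|_u$ (restriction) such that $1(u)=u$; $(ab)(u)=a(b(u))$; $a(1)=1$; $a|_1=a$; $1|_u=1$; $a|_{uv}=(a|_u)|_v$; $a(uv)=a(u)\,a|_u(v)$; $(ab)|_u=a|_{b(u)}\,b|_u$. Then $U\bowtie A$ is the set $U\times A$ with multiplication $(u,a)(v,b)=(u\,a(v),\,a|_v\,b)$. **Right LCM semigroups.** A monoid $S$ is right LCM if it is left cancellative and for all $s,t\in S$ the set $sS\cap tS$ is empty or of the form $rS$; such $r$ is a right LCM of $s,t$. $S^*$ is the group of invertible elements. $S_c=\{a\in S: aS\cap sS\ne\emptyset\ \forall s\in S\}$. $S_{ci}$ is the set of $s\in S\setminus S_c$ such that every factorisation $s=ta$ with $a\in S_c$ forces $a\in S^*$; $S_{ci}^1=S_{ci}\cup\{1\}$.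 $s\sim t$ means $sa=tb$ for some $a,b\in S_c$. A transversal for $A'/_\sim$, $A'\subset S$, is a subset of $A'$ that is a minimal complete set of representatives. A finite $F\subset S$ is a foundation set if every $s\in S$ satisfies $sS\cap fS\neq\emptyset$ for some $f\in F$; it is accurate if $fS\cap f'S=\emptyset$ for distinct $f,f'\in F$. **Admissibility.** For a submonoid $M$ of $\mathbb{N}^\times$, $\mathrm{Irr}(M)$ is the set of $m\in M$, $m\ne1$, such that $m=nk$ with $n,k\in M$ implies $n=1$ or $k=1$. A right LCM semigroup $S$ is admissible if: (A1) $S=S_{ci}^1S_c$; (A2) any right LCM of two elements of $S_{ci}$ belongs to $S_{ci}$; (A3) there is a nontrivial monoid homomorphism $N\colon S\to\mathbb{N}^\times$ (a generalised scale) such that (a) $|N^{-1}(n)/_\sim|=n$ for all $n\in N(S)$ and (b) for each $n\in N(S)$ every transversal of $N^{-1}(n)/_\sim$ is an accurate foundation set for $S$; (A4) $N(S)$ is the free abelian monoid in $\mathrm{Irr}(N(S))$. *)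

(* Defs.v *)
From HB Require Import structures.
From mathcomp Require Import all_boot.
From mathcomp Require Import finmap multiset.
From mathcomp Require Import boolp classical_sets functions cardinality.

Set Implicit Arguments.
Unset Strict Implicit.
Unset Printing Implicit Defensive.

Local Open Scope classical_set_scope.
Local Open Scope card_scope.
Local Open Scope group_scope.

Section RightLCM.
Variable S : monoidType.
Implicit Types (s t r : S) (A F T : set S).

Definition rideal s : set S := [set s * x | x in [set: S]].

Definition is_right_lcm s t r : Prop := rideal s `&` rideal t = rideal r.

Definition left_cancellative : Prop := forall s t r, s * t = s * r -> t = r.

Definition right_lcm_semigroup : Prop :=
  left_cancellative /\
  forall s t, rideal s `&` rideal t = set0 \/ exists r, is_right_lcm s t r.

Definition invertible : set S := [set s | exists t, s * t = 1 /\ t * s = 1].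

Definition core : set S :=
  [set a | forall s, rideal a `&` rideal s !=set0].

Definition core_irreducible : set S :=
  [set s | ~ core s /\ forall t a, core a -> s = t * a -> invertible a].

Definition core_irreducible1 : set S := core_irreducible `|` [set 1].

Definition core_equiv s t : Prop :=
  exists a b, [/\ core a, core b & s * a = t * b].

Definition core_classes A : set (set S) :=
  [set [set t | A t /\ core_equiv s t] | s in A].

Definition complete_representatives A T : Prop :=
  T `<=` A /\ forall s, A s -> exists2 t, T t & core_equiv s t.

Definition core_transversal A T : Prop :=
  complete_representatives A T /\
  forall T', complete_representatives A T' -> T' `<=` T -> T' = T.

Definition foundation_set F : Prop :=
  finite_set F /\ forall s, exists2 f, F f & rideal s `&` rideal f !=set0.

Definition accurate_foundation_set F : Prop :=
  foundation_set F /\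
  forall f f', F f -> F f' -> f <> f' -> rideal f `&` rideal f' = set0.

End RightLCM.

Definition Irr (M : set nat) : set nat :=
  [set m | [/\ M m, m <> 1%N &
    forall n k, M n -> M k -> m = (n * k)%N -> n = 1%N \/ k = 1%N]].

(* The free abelian monoid on a set is the monoid of finite multisets on it;
   M is free on Irr M when the canonical homomorphism sending a multiset of
   irreducibles to its product is a bijection onto M. *)
Definition free_abelian_in_Irr (M : set nat) : Prop :=
  set_bij [set m : {mset nat}%mset | forall k, k \in m -> Irr M k] M
          (fun m => (\prod_(k <- m) k)%N).

Section Admissible.
Variable S : monoidType.

(* The multiplicative monoid of positive integers is represented by nat-valued
   maps with positive values. *)
Definition nontrivial_hom (N : S -> nat) : Prop :=
  [/\ forall s, (0 < N s)%N,
      N 1 = 1%N,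
      forall s t, N (s * t) = (N s * N t)%N
    & exists s, N s <> 1%N].

Definition fiber (N : S -> nat) (n : nat) : set S := [set s | N s = n].

Definition generalised_scale (N : S -> nat) : Prop :=
  [/\ nontrivial_hom N,
      forall n, range N n -> core_classes (fiber N n) #= `I_n
    & forall n, range N n -> forall T,
        core_transversal (fiber N n) T -> accurate_foundation_set T].

Record admissible_with (N : S -> nat) : Prop := AdmissibleWith {
  admissible_right_lcm : right_lcm_semigroup S;
  admissible_factor : forall s : S, exists t a : S,
    [/\ core_irreducible1 t, core a & s = t * a];
  admissible_lcm : forall s t r : S, core_irreducible s -> core_irreducible t ->
    is_right_lcm s t r -> core_irreducible r;
  admissible_scale : generalised_scale N;
  admissible_free : free_abelian_in_Irr (range N)
}.

Definition admissible : Prop := exists N : S -> nat, admissible_with N.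

End Admissible.

Record zs_pair (U A : monoidType) := ZSPair {
  zs_act : A -> U -> U;
  zs_res : A -> U -> A;
  zs_act1u : forall u, zs_act 1 u = u;
  zs_actM : forall a b u, zs_act (a * b) u = zs_act a (zs_act b u);
  zs_acta1 : forall a, zs_act a 1 = 1;
  zs_resa1 : forall a, zs_res a 1 = a;
  zs_res1u : forall u, zs_res 1 u = 1;
  zs_resM : forall a u v, zs_res a (u * v) = zs_res (zs_res a u) v;
  zs_actuM : forall a u v,
    zs_act a (u * v) = zs_act a u * zs_act (zs_res a u) v;
  zs_resMu : forall a b u,
    zs_res (a * b) u = zs_res a (zs_act b u) * zs_res b u
}.

Definition zappa_szep (U A : monoidType) (Z : zs_pair U A) : Type :=
  (U * A)%type.

Section ZappaSzep.
Variables (U A : monoidType) (Z : zs_pair U A).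
Local Notation S := (zappa_szep Z).

Definition zs_mk (u : U) (a : A) : S := (u, a).

Definition zs_mul (x y : S) : S :=
  zs_mk (x.1 * zs_act Z x.2 y.1) (zs_res Z x.2 y.1 * y.2).

Definition zs_one : S := zs_mk 1 1.

Lemma zs_mulA : associative zs_mul.
Proof.
move=> [u a] [v b] [w c]; rewrite /zs_mul /zs_mk /=.
by congr pair; rewrite ?zs_actuM ?zs_actM ?zs_resM ?zs_resMu !mulgA.
Qed.

Lemma zs_mul1 : left_id zs_one zs_mul.
Proof.
by move=> [u a]; rewrite /zs_mul /zs_mk /= zs_act1u zs_res1u !mul1g.
Qed.

Lemma zs_mulr1 : right_id zs_one zs_mul.
Proof.
by move=> [u a]; rewrite /zs_mul /zs_mk /= zs_acta1 zs_resa1 !mulg1.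
Qed.

HB.instance Definition _ := Choice.on S.
HB.instance Definition _ :=
  isMonoid.Build S zs_mulA zs_mul1 zs_mulr1.

End ZappaSzep.

(* Main.v *)
Require Import Defs.
From mathcomp Require Import all_boot.
From mathcomp Require Import boolp classical_sets functions cardinality.

Local Open Scope classical_set_scope.
Local Open Scope group_scope.

(** Everything about admissibility is visible after projecting [S] to [U] by
    the first component.

    The compatibility hypothesis makes two principal right ideals
    [(u, a)S] and [(v, b)S] meet exactly when [uU] and [vU] meet.  Hence the
    core of [S] is [core U * A]: in particular every [(1, a)] lies in the core,
    which is why [(u, a)] and [(u, 1)] are equivalent and why the relation [~]
    on [S] is the pullback of the relation [~] on [U].  Removing a core factor
    from [(u, a) = (u, 1)(1, a)] forces [a] to be invertible in a
    core irreducible pair, and the core irreducible elements of [S] turn out to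
    be the pairs [(u, a)] with [u] core irreducible and [a] invertible.  From
    this the factorisation and the right LCM axioms transfer in both directions.

    For the scales, a generalised scale equals 1 on the core: an element of the
    core meets every ideal, so by accuracy a transversal of its fibre that
    contains it is a singleton.  So a generalised scale on [S] ignores the
    second component and has the form [N' \o fst]; comparing
    [(1, a)(u, 1) = (a(u), a|_u)] with [(u, 1)] shows that [N'] is invariant,
    and conversely invariance is exactly what makes [N' \o fst]
    multiplicative.  Since both the meeting of ideals and [~] are pulled back
    along the first projection, the classes, the transversals and the accurate
    foundation sets of the fibres of [N' \o fst] and of [N'] correspond. *)

(** * Right LCM monoids and their core *)

Section RightLCMFacts.
Local Set Implicit Arguments.
Local Unset Strict Implicit.
Variable S : monoidType.
Implicit Types (s t r a b : S) (B T : set S).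

(** Phrased as an equation because the computations below start from the
    cofactors of a common multiple, not from the multiple itself. *)
Definition rideals_meet s t : Prop := exists x y, s * x = t * y.

Lemma rideals_meetP s t :
  (rideal s `&` rideal t !=set0) <-> rideals_meet s t.
Proof.
split.
  by move=> [r [[x _ sx] [y _ ty]]]; exists x, y; rewrite sx ty.
by move=> [x [y e]]; exists (s * x); split; [exists x | exists y].
Qed.

Lemma rideals_disjointP s t :
  rideal s `&` rideal t = set0 <-> ~ rideals_meet s t.
Proof.
rewrite -rideals_meetP; split; first by move=> ->; case.
by move=> h; apply/eqP/negPn; apply/negP => /set0P.
Qed.

Lemma coreP s : core s <-> forall t, rideals_meet s t.
Proof. by split=> h t; apply/rideals_meetP; apply: h. Qed.

Lemma rideal_refl s : rideal s s.
Proof. by exists 1; rewrite ?mulg1. Qed.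

Lemma rideals_meetC s t : rideals_meet s t -> rideals_meet t s.
Proof. by move=> [x [y e]]; exists y, x. Qed.

Lemma core1 : core (1 : S).
Proof. by apply/coreP => t; exists t, 1; rewrite mul1g mulg1. Qed.

Lemma core_equiv_refl s : core_equiv s s.
Proof. by exists 1, 1; split=> //; apply: core1. Qed.

Lemma core_equiv_sym s t : core_equiv s t -> core_equiv t s.
Proof. by move=> [a [b [ca cb e]]]; exists b, a; split. Qed.

Lemma core_equiv_mulr s a : core a -> core_equiv (s * a) s.
Proof. by move=> ca; exists 1, a; split; rewrite ?mulg1 //; apply: core1. Qed.

Lemma invertible1 : invertible (1 : S).
Proof. by exists 1; rewrite mulg1. Qed.

Lemma rideal_mul_invertible s a :
  invertible a -> rideal (s * a) = rideal s.
Proof.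
move=> [b [ab _]]; apply/seteqP; split=> _ [x _ <-].
  by exists (a * x); rewrite // mulgA.
by exists (b * x); rewrite // mulgA -(mulgA s) ab mulg1.
Qed.

Lemma left_cancellative_invertible s t :
  left_cancellative S -> s * t = 1 -> invertible s /\ invertible t.
Proof.
move=> lc st; have ts : t * s = 1.
  by apply: (lc s); rewrite mulgA st mul1g mulg1.
by split; [exists t | exists s].
Qed.

Lemma invertibleM s t : invertible s -> invertible t -> invertible (s * t).
Proof.
move=> [s' [ss' s's]] [t' [tt' t't]]; exists (t' * s'); split.
  by rewrite mulgA -(mulgA s) tt' mulg1.
by rewrite mulgA -(mulgA t') s's mulg1.
Qed.

Lemma left_cancellative_invertible_rfactor s t :
  left_cancellative S -> invertible (s * t) -> invertible t.
Proof.
move=> lc [r [_ e]]; have e' : (r * s) * t = 1 by rewrite -mulgA.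
by case: (left_cancellative_invertible lc e').
Qed.

Lemma core_rfactor s t : left_cancellative S -> core (s * t) -> core t.
Proof.
move=> lc /coreP st; apply/coreP => r.
have [x [y e]] := st (s * r); exists x, y.
by apply: (lc s); rewrite !mulgA.
Qed.

Hypothesis rlcm : right_lcm_semigroup S.

(** For any [s], the core element [a] makes [aS] and [sS] meet, in a principal
    ideal [qS] since [S] is right LCM; the core element [b] makes [bS] meet
    [qS], so [rS], the intersection of [aS] and [bS], meets [sS]. *)
Lemma core_right_lcm a b r :
  core a -> core b -> is_right_lcm a b r -> core r.
Proof.
move=> /coreP ca /coreP cb lcmr; apply/coreP => s.
have [/rideals_disjointP h|[q q_lcm]] := rlcm.2 a s; first by case: h.
have [x [y bxqy]] := cb q.
have [aqy [w _ sw]] : (rideal a `&` rideal s) (q * y).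
  by rewrite q_lcm; exists y.
have [v _ rv] : rideal r (q * y) by rewrite -lcmr; split=> //; exists x.
by exists v, w; rewrite rv.
Qed.

Lemma core_mul a b : core a -> core b -> core (a * b).
Proof.
move=> /coreP ca /coreP cb; apply/coreP => s.
have [x [y axsy]] := ca s.
have [z [w bzxw]] := cb x.
by exists z, (y * w); rewrite -mulgA bzxw !mulgA axsy.
Qed.

(** Transitivity: the two core elements multiplying the middle term have a
    right LCM, and its cofactors are again in the core. *)
Lemma core_equiv_trans s t r :
  core_equiv s t -> core_equiv t r -> core_equiv s r.
Proof.
move=> [a [b [ca cb satb]]] [c [d [cc cd tcrd]]].
have [/rideals_disjointP h|[e e_lcm]] := rlcm.2 b c.
  by case: h; move/coreP: cb; apply.
have ce := core_right_lcm cb cc e_lcm.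
have [[x _ bx] [y _ cy]] : (rideal b `&` rideal c) e.
  by rewrite e_lcm; apply: rideal_refl.
have cx : core x by apply: (core_rfactor (s := b)); rewrite ?bx //; exact: rlcm.1.
have cy' : core y by apply: (core_rfactor (s := c)); rewrite ?cy //; exact: rlcm.1.
exists (a * x), (d * y); split; [exact: core_mul | exact: core_mul |].
by rewrite !mulgA satb -tcrd -!mulgA bx cy.
Qed.

Lemma core_transversalP B T :
  core_transversal B T <->
  complete_representatives B T /\
  (forall s t, T s -> T t -> core_equiv s t -> s = t).
Proof.
split=> [[[TB TC] Tmin]|[[TB TC] Tuniq]]; split=> //.
  move=> s t Ts Tt st; apply: contrapT => neq_st.
  have Tt' : (T `\ t) t.
    rewrite (Tmin (T `\ t)) //.
    split=> [r [/TB]//|r /TC [q Tq rq]].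
    have [qt|neq_qt] := pselect (q = t); last by exists q.
    exists s; first by split.
    by apply: core_equiv_trans rq _; rewrite qt; apply: core_equiv_sym.
  by case: Tt' => _; apply.
move=> T' [T'B T'C] T'T; apply/seteqP; split=> // s Ts.
have [t T't st] := T'C _ (TB _ Ts).
by rewrite (Tuniq s t) //; apply: T'T.
Qed.

Lemma core_transversal_containing B a :
  B a -> exists2 T, core_transversal B T & T a.
Proof.
move=> Ba.
(* Preferring a inside its own class is what puts a into the transversal. *)
pose cls s := [set t | B t /\ core_equiv s t].
pose rep s := if `[<cls s a>] then a else xget a (cls s).
have repP s : B s -> cls s (rep s).
  move=> Bs; rewrite /rep; case: asboolP => // _.
  by apply: xgetPex; exists s; split=> //; apply: core_equiv_refl.
have rep_eq s t : core_equiv s t -> rep s = rep t.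
  move=> st; rewrite /rep; suff -> : cls s = cls t by [].
  apply/seteqP; split=> r [Br h]; split=> //.
    exact: core_equiv_trans (core_equiv_sym st) h.
  exact: core_equiv_trans st h.
exists [set s | B s /\ rep s = s]; last first.
  split=> //; rewrite /rep; case: asboolP => // h.
  by case: h; split=> //; apply: core_equiv_refl.
apply/core_transversalP; split; first split.
- by move=> s [].
- move=> s Bs; have [Br sr] := repP s Bs; exists (rep s) => //; split=> //.
  by rewrite -(rep_eq _ _ sr).
- by move=> s t [_ rs] [_ rt] /rep_eq; rewrite rs rt.
Qed.

(** An element of the core is alone in any accurate foundation set, and it can
    be put in a transversal of its fibre; so the fibre has a single class. *)
Lemma generalised_scale_core (N : S -> nat) a :
  generalised_scale N -> core a -> N a = 1%N.
Proof.
move=> [_ Ncard Nacc] ca.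
have rNa : range N (N a) by exists a.
have [T trT Ta] := core_transversal_containing (erefl : fiber N (N a) a).
have [_ acc] := Nacc _ rNa T trT.
have Ta1 t : T t -> t = a.
  move=> Tt; apply: contrapT => /(acc t a Tt Ta)/rideals_disjointP; apply.
  by apply: rideals_meetC; move/coreP: ca; apply.
have [[TB TC] _] := trT.
have all_equiv s : N s = N a -> core_equiv s a.
  by move=> /TC [t /Ta1 ->].
have clsE : core_classes (fiber N (N a)) = [set fiber N (N a)].
  have cE s : N s = N a ->
      [set t | fiber N (N a) t /\ core_equiv s t] = fiber N (N a).
    move=> Ns; apply/seteqP; split=> [t []//|t Nt]; split=> //.
    apply: core_equiv_trans (all_equiv _ Ns) _.
    by apply: core_equiv_sym; apply: all_equiv.
  apply/seteqP; split=> [_ [s Ns <-]|_ ->]; first by rewrite /= cE.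
  by exists a => //; rewrite cE.
have := Ncard _ rNa; rewrite clsE => h.
have : (`I_1 #= `I_(N a))%card.
  by apply: card_eq_trans h; rewrite card_eq_sym; apply: card_set1.
by move/card_eq_II => <-.
Qed.

End RightLCMFacts.

(** * Generalised scales pulled back along a projection *)

Section Pullback.
Local Set Implicit Arguments.
Local Unset Strict Implicit.
Variables (S U : monoidType) (p : S -> U) (sec : U -> S).
Hypotheses (secK : cancel sec p)
  (meet_p : forall s t, rideals_meet s t <-> rideals_meet (p s) (p t))
  (equiv_p : forall s t, core_equiv s t <-> core_equiv (p s) (p t)).
Hypotheses (rlcmS : right_lcm_semigroup S) (rlcmU : right_lcm_semigroup U).
Variable N : U -> nat.

Lemma range_comp_split : range (N \o p) = range N.
Proof.
apply/seteqP; split=> _ [x _ <-]; first by exists (p x).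
by exists (sec x) => //=; rewrite secK.
Qed.

(** The classes of [N \o p] are the preimages of those of [N], and taking
    preimages is injective because [p] is surjective. *)
Lemma card_core_classes_pullback n :
  (core_classes (fiber (N \o p) n) #= core_classes (fiber N n))%card.
Proof.
have -> : core_classes (fiber (N \o p) n) =
    (fun C : set U => p @^-1` C) @` core_classes (fiber N n).
  have preimE s : [set t | fiber (N \o p) n t /\ core_equiv s t] =
      p @^-1` [set t | fiber N n t /\ core_equiv (p s) t].
    by apply/seteqP; split=> t [Nt /equiv_p e].
  apply/seteqP; split=> [_ [s Ns <-]|_ [_ [u Nu <-] <-]].
    exists [set t | fiber N n t /\ core_equiv (p s) t]; last by rewrite -preimE.
    by exists (p s).
  exists (sec u); first by rewrite /fiber /= secK.
  by rewrite preimE secK.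
apply: inj_card_eq => C D _ _ CD; apply/seteqP; split=> u.
  by rewrite -{1 2}(secK u) -[C _]/((p @^-1` C) (sec u)) CD.
by rewrite -{1 2}(secK u) -[D _]/((p @^-1` D) (sec u)) -CD.
Qed.

Lemma accurate_foundation_set_image (T : set S) :
  {in T &, injective p} ->
  accurate_foundation_set T <-> accurate_foundation_set (p @` T).
Proof.
move=> injT; split=> [[[finT fndT] acc]|[[finT fndT] acc]]; (split; first split).
- exact: finite_image.
- move=> u; have [f Tf /rideals_meetP/meet_p] := fndT (sec u).
  by rewrite secK => h; exists (p f); [exists f | apply/rideals_meetP].
- move=> _ _ [s Ts <-] [t Tt <-] neq.
  have /rideals_disjointP h : rideal s `&` rideal t = set0.
    by apply: acc => // st; apply: neq; rewrite st.
  by apply/rideals_disjointP => /meet_p.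
- by rewrite -(eq_finite_set (inj_card_eq injT)).
- move=> s; have [_ [f Tf <-] /rideals_meetP/meet_p h] := fndT (p s).
  by exists f => //; apply/rideals_meetP.
- move=> s t Ts Tt neq; apply/rideals_disjointP => /meet_p; apply/rideals_disjointP.
  by apply: acc; [exists s | exists t | move/(injT _ _ (mem_set Ts) (mem_set Tt))].
Qed.

Lemma core_transversal_image n (T : set S) :
  core_transversal (fiber (N \o p) n) T ->
  {in T &, injective p} /\ core_transversal (fiber N n) (p @` T).
Proof.
move=> /(core_transversalP rlcmS) [[TB TC] Tuniq]; split.
  move=> s t /set_mem Ts /set_mem Tt st; apply: Tuniq => //.
  by apply/equiv_p; rewrite st; apply: core_equiv_refl.
apply/(core_transversalP rlcmU); split; first split.
- by move=> _ [s /TB Ns <-].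
- move=> u Nu; have [|t Tt /equiv_p] := TC (sec u); first by rewrite /fiber /= secK.
  by rewrite secK => ut; exists (p t) => //; exists t.
- by move=> _ _ [s Ts <-] [t Tt <-] /equiv_p st; rewrite (Tuniq s t).
Qed.

Lemma core_transversal_section n (T : set U) :
  core_transversal (fiber N n) T ->
  core_transversal (fiber (N \o p) n) (sec @` T).
Proof.
move=> /(core_transversalP rlcmU) [[TB TC] Tuniq].
apply/(core_transversalP rlcmS); split; first split.
- by move=> _ [u /TB Nu <-]; rewrite /fiber /= secK.
- move=> s /TC [t Tt st]; exists (sec t); first by exists t.
  by apply/equiv_p; rewrite secK.
- move=> _ _ [u Tu <-] [v Tv <-] /equiv_p; rewrite !secK => uv.
  by rewrite (Tuniq u v).
Qed.

Lemma generalised_scale_pullback :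
  nontrivial_hom (N \o p) -> nontrivial_hom N ->
  generalised_scale (N \o p) <-> generalised_scale N.
Proof.
move=> homS homU; split=> -[_ Ncard Nacc]; split=> //.
- move=> n; rewrite -range_comp_split => /Ncard; apply: card_eq_trans.
  by rewrite card_eq_sym; apply: card_core_classes_pullback.
- move=> n; rewrite -range_comp_split => rn T trT.
  have trsT := core_transversal_section trT.
  have [inj_sT _] := core_transversal_image trsT.
  have := Nacc n rn _ trsT; rewrite accurate_foundation_set_image //.
  by rewrite image_comp eq_image_id // => u _ /=.
- move=> n; rewrite range_comp_split => /Ncard; apply: card_eq_trans.
  exact: card_core_classes_pullback.
- move=> n; rewrite range_comp_split => rn T trT.
  have [injT trpT] := core_transversal_image trT.
  by apply/accurate_foundation_set_image => //; apply: Nacc trpT.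
Qed.

End Pullback.

(** * Projecting a Zappa-Szep product to its first factor *)

Section Projection.
Local Set Implicit Arguments.
Local Unset Strict Implicit.
Variables (U A : monoidType) (Z : zs_pair U A).
Local Notation S := (zappa_szep Z).
Local Notation mk := (zs_mk Z).
Hypotheses (lcm_S : right_lcm_semigroup S) (lcm_A : right_lcm_semigroup A).
Hypothesis lcm_compat : forall (u v : U) (a b : A) (w : U),
  rideal u `&` rideal v = rideal w ->
  exists c : A, rideal (mk u a) `&` rideal (mk v b) = rideal (mk w c).

(** The first projection on the type [S] that carries the Zappa-Szep
    multiplication rather than on the bare product of types. *)
Definition first (s : S) : U := s.1.

Lemma mk_mul u a v b :
  mk u a * mk v b = mk (u * zs_act Z a v) (zs_res Z a v * b).
Proof. by []. Qed.

Lemma mk1_mul u v b : mk u 1 * mk v b = mk (u * v) b.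
Proof. by rewrite mk_mul zs_act1u zs_res1u mul1g. Qed.

Lemma mk_mul1 u a b : mk u a * mk 1 b = mk u (a * b).
Proof. by rewrite mk_mul zs_acta1 zs_resa1 mulg1. Qed.

Lemma mk_inj u a v b : mk u a = mk v b -> u = v /\ a = b.
Proof. by case. Qed.

Lemma left_cancellative_first : left_cancellative U.
Proof.
move=> u v w uvw; have : mk u 1 * mk v 1 = mk u 1 * mk w 1.
  by rewrite !mk1_mul uvw.
by move/lcm_S.1/mk_inj => [].
Qed.

(** A common right multiple [z] of [u] and [v] yields the common right multiple
    [(z, 1)] of [(u, 1)] and [(v, 1)], whose first component then is
    [w * c(k)] for some [k]. *)
Lemma is_right_lcm_first u v w c :
  is_right_lcm (mk u 1) (mk v 1) (mk w c) -> is_right_lcm u v w.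
Proof.
move=> lcm_w.
have [[[x a] _ uxw] [[y b] _ vyw]] :
    (rideal (mk u 1) `&` rideal (mk v 1)) (mk w c).
  by rewrite lcm_w; apply: rideal_refl.
move: uxw vyw; rewrite -[(x, a)]/(mk x a) -[(y, b)]/(mk y b) !mk1_mul.
move=> /mk_inj[uxw _] /mk_inj[vyw _].
apply/seteqP; split=> [z [[x' _ ux'] [y' _ vy']]|_ [k _ <-]]; last first.
  split; first by exists (x * k); rewrite // mulgA uxw.
  by exists (y * k); rewrite // mulgA vyw.
have [[k d] _ wkz] : rideal (mk w c) (mk z 1).
  rewrite -lcm_w; split.
    by exists (mk x' 1); rewrite // mk1_mul ux'.
  by exists (mk y' 1); rewrite // mk1_mul vy'.
move: wkz; rewrite -[(k, d)]/(mk k d) mk_mul => /mk_inj[wkz _].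
by exists (zs_act Z c k).
Qed.

Lemma right_lcm_first : right_lcm_semigroup U.
Proof.
split=> [|u v]; first exact: left_cancellative_first.
have [/rideals_disjointP disj|[[w c] lcm_w]] := lcm_S.2 (mk u 1) (mk v 1).
  left; apply/rideals_disjointP => -[x [y uxvy]]; apply: disj.
  by exists (mk x 1), (mk y 1); rewrite !mk1_mul uxvy.
by right; exists w; apply: (@is_right_lcm_first _ _ _ c).
Qed.

Lemma rideals_meet_first (s t : S) :
  rideals_meet s t <-> rideals_meet (first s) (first t).
Proof.
case: s t => [u a] [v b]; split.
  move=> [[x c] [[y d]]] /mk_inj[uxvy _].
  by exists (zs_act Z a x), (zs_act Z b y).
move=> meet_uv.
have [/rideals_disjointP //|[w lcm_w]] := right_lcm_first.2 u v.
have [c lcm_c] := lcm_compat a b lcm_w.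
by apply/rideals_meetP; rewrite lcm_c; exists (mk w c); apply: rideal_refl.
Qed.

Lemma core_first (s : S) : core s <-> core (first s).
Proof.
split=> /coreP cs; apply/coreP => t.
  exact: (rideals_meet_first s (mk t 1)).1 (cs _).
by apply/rideals_meet_first.
Qed.

Lemma core_mk1 a : core (mk 1 a).
Proof. by apply/core_first; apply: core1. Qed.

(** The action preserves the core of [U], since [a(x)] is the first component
    of the product of the core elements [(1, a)] and [(x, 1)]. *)
Lemma core_act a x : core x -> core (zs_act Z a x).
Proof.
move=> cx; have : core (mk 1 a * mk x 1).
  by apply: core_mul; [exact: core_mk1 | apply/core_first].
by rewrite mk_mul mul1g => /core_first.
Qed.

Lemma core_equiv_first (s t : S) :
  core_equiv s t <-> core_equiv (first s) (first t).
Proof.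
case: s t => [u a] [v b]; split.
  move=> [[x c] [[y d] [/core_first cx /core_first cy /mk_inj[uxvy _]]]].
  by exists (zs_act Z a x), (zs_act Z b y); split=> //; apply: core_act.
move=> [x [y [cx cy uxvy]]].
have forget w e : core_equiv (mk w e) (mk w 1).
  by rewrite -{1}(mul1g e) -mk_mul1; apply: core_equiv_mulr; apply: core_mk1.
apply: (core_equiv_trans lcm_S (forget u a)).
apply: (core_equiv_trans lcm_S _ (core_equiv_sym (forget v b))).
by exists (mk x 1), (mk y 1); rewrite !mk1_mul uxvy; split=> //; apply/core_first.
Qed.

Lemma invertible_mk u a : invertible (mk u a) <-> invertible u /\ invertible a.
Proof.
split=> [[[x c] [/mk_inj[uax _] /mk_inj[_ cua]]]|].
  have [iu _] := left_cancellative_invertible left_cancellative_first uax.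
  by have [_ ia] := left_cancellative_invertible lcm_A.1 cua.
move=> [[u' [uu' u'u]] [a' [aa' a'a]]].
rewrite -[a]mul1g -mk_mul1; apply: invertibleM.
  by exists (mk u' 1); rewrite !mk1_mul uu' u'u.
by exists (mk 1 a'); rewrite !mk_mul1 aa' a'a.
Qed.

(** A core factor can always be split off as [(u, a) = (u, 1)(1, a)], so [a]
    has to be invertible; conversely, if [(u, a) = (v, b)(x, c)] with [a]
    invertible and [u] core irreducible, then [(1, b)(x, c)] has invertible
    components, hence so does its right factor [(x, c)]. *)
Lemma core_irreducible_mk u a :
  core_irreducible (mk u a) <-> core_irreducible u /\ invertible a.
Proof.
split=> [[ncua irr]|[[ncu irr] ia]].
  split; last first.
    have /invertible_mk[] // : invertible (mk 1 a).
    by apply: (irr (mk u 1)); rewrite ?mk_mul1 ?mul1g //; apply: core_mk1.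
  split=> [cu|v x cx uvx]; first by apply: ncua; apply/core_first.
  have /invertible_mk[] // : invertible (mk x a).
  by apply: (irr (mk v 1)); rewrite ?mk1_mul ?uvx //; apply/core_first.
split=> [/core_first //|[v b] [x c] /core_first cx /mk_inj[uvx abc]].
apply: (left_cancellative_invertible_rfactor (s := mk 1 b) lcm_S.1).
rewrite -[(x, c)]/(mk x c) mk_mul mul1g; apply/invertible_mk; split.
  by apply: irr uvx; apply: core_act.
by rewrite -abc.
Qed.

Lemma core_factor_first :
  (forall s : S, exists t a, [/\ core_irreducible1 t, core a & s = t * a]) <->
  (forall u : U, exists t a, [/\ core_irreducible1 t, core a & u = t * a]).
Proof.
split=> [fac u|fac [u a]].
  have [[t b] [[x c] [irr /core_first cx /mk_inj[utx _]]]] := fac (mk u 1).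
  exists t, (zs_act Z b x); split=> //; last exact: core_act.
  case: irr => [/core_irreducible_mk[irr_t _]|/mk_inj[t1 _]]; first by left.
  by right.
have [t [x [irr cx ->]]] := fac u.
exists (mk t 1), (mk x a); rewrite mk1_mul; split=> //; last exact/core_first.
case: irr => [irr_t|->]; last by right.
by left; apply/core_irreducible_mk; split=> //; apply: invertible1.
Qed.

(** Given a right LCM [(r, c)] of core irreducible pairs, [r] is a right LCM
    of their first components.  The pair [(r, 1)] is then a common multiple
    too, so it lies in the ideal of [(r, c)], which makes [c] invertible. *)
Lemma core_irreducible_lcm_first :
  (forall s t r : S, core_irreducible s -> core_irreducible t ->
    is_right_lcm s t r -> core_irreducible r) <->
  (forall u v w : U, core_irreducible u -> core_irreducible v ->
    is_right_lcm u v w -> core_irreducible w).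
Proof.
split=> [irr_lcm u v w irr_u irr_v lcm_w|irr_lcm [u a] [v b] [r c]].
  have [c lcm_c] := lcm_compat 1 1 lcm_w.
  suff /core_irreducible_mk[] : core_irreducible (mk w c) by [].
  apply: irr_lcm lcm_c; apply/core_irreducible_mk; split=> //;
    exact: invertible1.
move=> /core_irreducible_mk[irr_u ia] /core_irreducible_mk[irr_v ib].
have drop_inv w e : invertible e -> rideal (mk w e) = rideal (mk w 1).
  move=> ie; rewrite -[e]mul1g -mk_mul1 rideal_mul_invertible //.
  by apply/invertible_mk; split=> //; apply: invertible1.
rewrite /is_right_lcm (drop_inv u a ia) (drop_inv v b ib) => lcm_c.
have lcm_r := is_right_lcm_first lcm_c.
apply/core_irreducible_mk; split; first exact: irr_lcm lcm_r.
have [[x _ ux] [y _ vy]] : (rideal u `&` rideal v) r.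
  by rewrite lcm_r; apply: rideal_refl.
have [s _ rcs] : rideal (mk r c) (mk r 1).
  rewrite -[rideal (mk r c)]lcm_c; split.
    by exists (mk x 1); rewrite // mk1_mul ux.
  by exists (mk y 1); rewrite // mk1_mul vy.
have : mk 1 c * s = 1.
  by apply: (lcm_S.1 (mk r 1)); rewrite mulgA mk_mul1 mul1g rcs mulg1.
by move/(left_cancellative_invertible lcm_S.1) => [/invertible_mk[]].
Qed.

Lemma nontrivial_hom_first (N : U -> nat) :
  (forall a u, N (zs_act Z a u) = N u) ->
  nontrivial_hom (N \o first) <-> nontrivial_hom N.
Proof.
move=> invN; split=> -[pos N1 NM [s Ns]]; split=> //.
- by move=> u; apply: (pos (mk u 1)).
- by move=> u v; have := NM (mk u 1) (mk v 1); rewrite mk1_mul.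
- by exists (first s).
- by move=> [u a]; apply: (pos u).
- by move=> [u a] [v b]; rewrite /= /first /= NM invN.
- by exists (mk s 1).
Qed.

Lemma admissible_with_first (N : U -> nat) :
  (forall a u, N (zs_act Z a u) = N u) ->
  admissible_with (N \o first) <-> admissible_with N.
Proof.
move=> invN.
have rangeE : range (N \o first) = range N.
  exact: (range_comp_split (sec := mk ^~ 1)).
have homE := nontrivial_hom_first invN.
have scaleE : nontrivial_hom N ->
    generalised_scale (N \o first) <-> generalised_scale N.
  move=> homN; apply: (@generalised_scale_pullback _ _ first (mk ^~ 1)) => //.
  - exact: rideals_meet_first.
  - exact: core_equiv_first.
  - exact: right_lcm_first.
  - exact/homE.
split=> -[_ fac lcm scale free]; split=> //.
- exact: right_lcm_first.
- exact/core_factor_first.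
- exact/core_irreducible_lcm_first.
- by apply/scaleE => //; apply/homE; case: scale.
- by rewrite -rangeE.
- exact/core_factor_first.
- exact/core_irreducible_lcm_first.
- by apply/scaleE => //; case: scale.
- by rewrite rangeE.
Qed.

(** The second component does not contribute to a generalised scale because
    [(1, a)] lies in the core; comparing the two factorisations of
    [(1, a)(u, 1) = (a(u), a|_u)] then gives the invariance. *)
Lemma generalised_scale_first (N : S -> nat) :
  generalised_scale N ->
  N = (fun u => N (mk u 1)) \o first /\
  forall a u, N (mk (zs_act Z a u) 1) = N (mk u 1).
Proof.
move=> scaleN; have [[_ _ NM _] _ _] := scaleN.
have forget u a : N (mk u a) = N (mk u 1).
  rewrite -{1}(mul1g a) -mk_mul1 NM.
  by rewrite (generalised_scale_core lcm_S scaleN (core_mk1 a)) muln1.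
split=> [|a u]; first by apply/funext => -[u a]; apply: forget.
rewrite -(forget _ (zs_res Z a u)).
have -> : mk (zs_act Z a u) (zs_res Z a u) = mk 1 a * mk u 1.
  by rewrite mk_mul mul1g mulg1.
by rewrite NM (generalised_scale_core lcm_S scaleN (core_mk1 a)) mul1n.
Qed.

End Projection.

Theorem corollary5p5 (U A : monoidType)
  (countable_U : countable [set: U]) (countable_A : countable [set: A])
  (Z : zs_pair U A)
  (lcm_S : right_lcm_semigroup (zappa_szep Z))
  (lcm_A : right_lcm_semigroup A)
  (lcm_compat : forall (u v : U) (a b : A) (w : U),
     rideal u `&` rideal v = rideal w ->
     exists c : A,
       rideal (zs_mk Z u a) `&` rideal (zs_mk Z v b) = rideal (zs_mk Z w c)) :
  admissible (zappa_szep Z) <->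
  exists N' : U -> nat,
    admissible_with N' /\
    (forall (a : A) (u : U), N' (zs_act Z a u) = N' u).
Proof.
split=> [[N admN]|[N' [admN' invN']]].
  have [NE invN] :=
    generalised_scale_first lcm_S lcm_compat (admissible_scale admN).
  exists (fun u => N (zs_mk Z u 1)); split=> //.
  by apply/(admissible_with_first lcm_S lcm_A lcm_compat invN); rewrite -NE.
exists (N' \o first (Z := Z)).
exact/(admissible_with_first lcm_S lcm_A lcm_compat invN').
Qed.
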